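(* (Setting (2.a)) There is a subgroup of $\mathbb{Z}^{\mathbb{N}}$ which is Hurewicz-bounded and Menger-bounded, but is not Rothberger-bounded and has none of the Hurewicz, Menger, and Rothberger properties.
   Context: The group $\mathbb{Z}^{\mathbb{N}}$ carries pointwise addition and the product topology ($\mathbb{Z}$ discrete); subgroups carry the subspace topology. For a topological group $(G,\cdot)$, with the condition required for each sequence $(U_n)_{n\in\mathbb{N}}$ of neighborhoods of the unit: $G$ is Menger-bounded if there are finite $F_n\subseteq G$ with $G=\bigcup_n F_n\cdot U_n$; Hurewicz-bounded if there are finite $F_n\subseteq G$ such that each $g\in G$ belongs to $F_n\cdot U_n$ for all but finitely many $n$; Rothberger-bounded if there are $a_n\in G$ with $G=\bigcup_n a_n\cdot U_n$. For a topological space $X$, with the condition required for each sequence $(\mathcal{U}_n)_{n\in\mathbb{N}}$ of open covers of $X$: $X$ has the Menger property if there are finite $\mathcal{F}_n\subseteq\mathcal{U}_n$ such that $\bigcup_n\mathcal{F}_n$ covers $X$; the Hurewicz property if there are finite $\mathcal{F}_n\subseteq\mathcal{U}_n$ such that each $x\in X$ belongs to $\bigcup_{U\in\mathcal{F}_n}U$ for all but finitely many $n$; the Rothberger property if there are $U_n\in\mathcal{U}_n$ with $X=\bigcup_n U_n$. *)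

(* Defs.v *)
From HB Require Import structures.
From mathcomp Require Import all_boot all_order all_algebra.
From mathcomp Require Import all_classical all_reals all_analysis.

Set Implicit Arguments.
Unset Strict Implicit.
Unset Printing Implicit Defensive.

Import GRing.Theory.
Local Open Scope classical_set_scope.
Local Open Scope ring_scope.

Lemma ptws_near_coord (T : discreteTopologicalType) (f : {ptws nat -> T})
    (n : nat) : nbhs f [set g : {ptws nat -> T} | g n = f n].
Proof.
have := @proj_continuous nat (fun=> T) n f.
by move/(_ [set f n] (discrete_set1 _)).
Qed.

Lemma ptws_discrete_cvg (T : discreteTopologicalType)
    (F : set_system {ptws nat -> T}) (FF : Filter F) (f : {ptws nat -> T}) :
  (forall n, F [set g | g n = f n]) -> F --> f.
Proof.
move=> Ff; apply/cvg_sup => n; apply/cvg_image.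
  by rewrite eqEsubset; split=> // k _; exists (fun=> k).
move=> A /nbhs_singleton Afn.
exists [set g : {ptws nat -> T} | A (g n)].
  by apply: filterS (Ff n) => g /= ->.
by rewrite eqEsubset; split=> [_ [g Ag <-]|k Ak] //; exists (fun=> k).
Qed.

(* [discrete_topology int] because [int] carries no topology in the library. *)
Definition ZN : Type := {ptws nat -> discrete_topology int}.

HB.instance Definition _ := GRing.Zmodule.copy ZN (nat -> int).
HB.instance Definition _ :=
  Topological.copy ZN {ptws nat -> discrete_topology int}.

Lemma ZN_sub_continuous : continuous (fun x : ZN * ZN => x.1 - x.2).
Proof.
move=> [f g].
have H n : nbhs ((f, g) : (ZN * ZN)%type) [set x | (x.1 - x.2) n = (f - g) n].
  exists ([set h : ZN | h n = f n], [set h : ZN | h n = g n]).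
    by split; exact: (@ptws_near_coord (discrete_topology int)).
  move=> [f' g'] [/= ff' gg'].
  have E (a b : ZN) : (a - b) n = (a n : int) - (b n : int) by [].
  by rewrite !E ff' gg'.
(* The filter instance is built by hand: its inference diverges here. *)
have FF : Filter (nbhs ((f, g) : (ZN * ZN)%type)) by apply: nbhs_filter.
have FF2 := @fmap_filter _ _ (fun x : ZN * ZN => x.1 - x.2) _ FF.
exact: (@ptws_discrete_cvg (discrete_topology int) _ FF2 (f - g) H).
Qed.

HB.instance Definition _ :=
  PreTopologicalNmodule_isTopologicalZmodule.Build ZN ZN_sub_continuous.

Section Subgroup.
Context (V : topologicalZmodType) (G : zmodClosed V).

Definition subgroup : Type := {x : V | x \in G}.

HB.instance Definition _ := SubChoice.on subgroup.
HB.instance Definition _ := [SubChoice_isSubZmodule of subgroup by <:].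
HB.instance Definition _ :=
  Topological.copy subgroup (initial_topology (val : subgroup -> V)).

Lemma subgroup_sub_continuous :
  continuous (fun x : subgroup * subgroup => x.1 - x.2).
Proof.
have valc : continuous (val : subgroup -> V) by exact: initial_continuous.
apply/continuousP => _ [A oA <-].
have valB : (fun x : subgroup * subgroup => val x.1 - val x.2) @^-1` A =
    (fun x : subgroup * subgroup => x.1 - x.2) @^-1` (val @^-1` A).
  by [].
rewrite -valB; move: A oA {valB}; apply/continuousP => x.
apply: (@continuous_comp _ _ _
  (fun x : subgroup * subgroup => (val x.1, val x.2)) (fun x : V * V => x.1 - x.2)).
  apply: cvg_pair; apply: continuous_comp;
    by [exact: cvg_fst | exact: cvg_snd | exact: valc].
exact: sub_continuous.
Qed.

HB.instance Definition _ :=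
  PreTopologicalNmodule_isTopologicalZmodule.Build subgroup
    subgroup_sub_continuous.

End Subgroup.

Section GroupBoundedness.
Context (G : topologicalZmodType).

Definition translates (F U : set G) : set G := [set a + u | a in F & u in U].

Definition Menger_bounded : Prop :=
  forall U : nat -> set G, (forall n, nbhs 0 (U n)) ->
  exists F : nat -> set G, (forall n, finite_set (F n)) /\
    \bigcup_n translates (F n) (U n) = [set: G].

Definition Hurewicz_bounded : Prop :=
  forall U : nat -> set G, (forall n, nbhs 0 (U n)) ->
  exists F : nat -> set G, (forall n, finite_set (F n)) /\
    forall g : G, \forall n \near \oo, translates (F n) (U n) g.

Definition Rothberger_bounded : Prop :=
  forall U : nat -> set G, (forall n, nbhs 0 (U n)) ->
  exists a : nat -> G, \bigcup_n translates [set a n] (U n) = [set: G].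

End GroupBoundedness.

Section CoveringProperties.
Context (X : topologicalType).

Definition open_cover (U : set (set X)) : Prop :=
  U `<=` open /\ \bigcup_(A in U) A = [set: X].

Definition Menger_property : Prop :=
  forall U : nat -> set (set X), (forall n, open_cover (U n)) ->
  exists F : nat -> set (set X),
    (forall n, finite_set (F n) /\ F n `<=` U n) /\
    \bigcup_n \bigcup_(A in F n) A = [set: X].

Definition Hurewicz_property : Prop :=
  forall U : nat -> set (set X), (forall n, open_cover (U n)) ->
  exists F : nat -> set (set X),
    (forall n, finite_set (F n) /\ F n `<=` U n) /\
    forall x : X, \forall n \near \oo, (\bigcup_(A in F n) A) x.

Definition Rothberger_property : Prop :=
  forall U : nat -> set (set X), (forall n, open_cover (U n)) ->
  exists V : nat -> set X, (forall n, U n (V n)) /\ \bigcup_n V n = [set: X].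

End CoveringProperties.

Arguments Menger_bounded : clear implicits.
Arguments Hurewicz_bounded : clear implicits.
Arguments Rothberger_bounded : clear implicits.
Arguments Menger_property : clear implicits.
Arguments Hurewicz_property : clear implicits.
Arguments Rothberger_property : clear implicits.

(* Main.v *)
(** Let G be the group of bounded integer matrices (indexed by nat * nat, read
    as sequences through a pairing function) all of whose rows have finite
    support.  A bounded group is Hurewicz-bounded: up to the first m
    coordinates, an element bounded by n is one of finitely many truncations,
    and truncations stay in G.  The first column of an element of G can be any
    0/1 sequence, so G escapes every sequence of single translates by a
    diagonal argument.  For each n, the sets [g n k = 0], for k ranging over
    nat, form an open cover of G; against finitely many k for each n, take the
    matrix whose n-th row is 1 up to the largest of these k and 0 afterwards.
    Hence G is not Menger, and a fortiori neither Hurewicz nor Rothberger. *)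

Require Import Defs.
From HB Require Import structures.
From mathcomp Require Import all_boot all_order all_algebra.
From mathcomp Require Import all_classical all_reals all_analysis.
From mathcomp Require Import zify.

Set Implicit Arguments.
Unset Strict Implicit.
Unset Printing Implicit Defensive.

Import Order.TTheory GRing.Theory Num.Theory.
Local Open Scope classical_set_scope.
Local Open Scope ring_scope.

Lemma Hurewicz_bounded_Menger (G : topologicalZmodType) :
  Hurewicz_bounded G -> Menger_bounded G.
Proof.
move=> H U U0; have [F [finF FU]] := H U U0.
exists F; split=> //; rewrite -subTset => g _.
by have [n _ /(_ n (leqnn n))] := FU g; exists n.
Qed.

Lemma Hurewicz_Menger (X : topologicalType) :
  Hurewicz_property X -> Menger_property X.
Proof.
move=> H U Uc; have [F [finF FU]] := H U Uc.
exists F; split=> //; rewrite -subTset => x _.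
by have [n _ /(_ n (leqnn n))] := FU x; exists n.
Qed.

Lemma Rothberger_Menger (X : topologicalType) :
  Rothberger_property X -> Menger_property X.
Proof.
move=> H U Uc; have [V [UV VT]] := H U Uc.
exists (fun n => [set V n]); split=> [n|].
  by split=> [|_ ->]; [exact: finite_set1 | exact: UV].
by rewrite -VT; apply: eq_bigcupr => n _; rewrite bigcup_set1.
Qed.

(** The sets containing a cylinder around [f] form a filter [F]. It contains every condition fixing
    a single coordinate, so it converges to [f], which says exactly that each neighborhood of [f]
    lies in [F]. *)
Lemma nbhs_ZN_prefix (f : ZN) (A : set ZN) : nbhs f A ->
  exists m, forall g : ZN, (forall i, (i < m)%N -> g i = f i) -> A g.
Proof.
pose F : set_system ZN := [set A | exists m, forall g : ZN,
  (forall i, (i < m)%N -> g i = f i) -> A g].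
have FF : Filter F.
  split=> [|P Q [m mP] [n nQ]|P Q PQ [m mP]].
  - by exists 0%N.
  - exists (maxn m n) => g gf; split.
      by apply: mP => i im; apply: gf; rewrite leq_max im.
    by apply: nQ => i im; apply: gf; rewrite leq_max im orbT.
  - by exists m => g /mP /PQ.
apply: (@ptws_discrete_cvg (discrete_topology int) F FF f) => n.
by exists n.+1 => g; apply.
Qed.

Lemma open_ZN_coord0 (i : nat) : open [set f : ZN | (f i : int) = 0].
Proof.
rewrite openE => f /= f0; rewrite /interior.
have := @ptws_near_coord (discrete_topology int) f i.
by apply: filterS => g /= ->.
Qed.

Lemma open_subgroup_coord0 (G : zmodClosed ZN) (i : nat) :
  open [set g : subgroup G | (val g i : int) = 0].
Proof. by exists [set f : ZN | (f i : int) = 0]; first exact: open_ZN_coord0. Qed.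

Lemma nbhs_subgroup_prefix (G : zmodClosed ZN) (U : set (subgroup G)) :
  nbhs 0 U -> exists m, forall g : subgroup G,
    (forall i, (i < m)%N -> (val g i : int) = 0) -> U g.
Proof.
rewrite nbhsE => -[B [[A oA <-] A0] AU].
have /nbhs_ZN_prefix[m mA] : nbhs (0 : ZN) A by exact: open_nbhs_nbhs.
by exists m => g g0; apply: AU; apply: mA.
Qed.

(** Coordinate [pickle (n, k)] is the matrix entry in row [n], column [k]; a coordinate that codes
    no pair is restricted only by the bound. *)
Definition bounded_finite_rows (f : ZN) : Prop :=
  (exists B : nat, forall i, `|f i : int| <= B%:Z) /\
  (forall n : nat, exists K, forall k : nat,
    (K <= k)%N -> (f (pickle (n, k)) : int) = 0).

Definition bounded_finite_rows_pred : pred ZN :=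
  fun f => `[< bounded_finite_rows f >].

Fact bounded_finite_rows_zmod_closed : zmod_closed bounded_finite_rows_pred.
Proof.
split=> [|f g /asboolP[[B fB] fK] /asboolP[[C gC] gK]]; apply/asboolP; split.
- by exists 0%N.
- by move=> n; exists 0%N.
- exists (B + C)%N => i; rewrite PoszD; apply: le_trans (lerD (fB i) (gC i)).
  exact: ler_normB.
- move=> n; have [K fK0] := fK n; have [L gL0] := gK n.
  exists (maxn K L) => k; rewrite geq_max => /andP[Kk Lk].
  have -> : ((f - g) (pickle (n, k)) : int) =
    (f (pickle (n, k)) : int) - (g (pickle (n, k)) : int) by [].
  by rewrite fK0 // gL0.
Qed.

HB.instance Definition _ :=
  GRing.isZmodClosed.Build ZN bounded_finite_rows_pred
    bounded_finite_rows_zmod_closed.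

Definition matrix_group : zmodClosed ZN :=
  GRing.ZmodClosed.clone ZN bounded_finite_rows_pred _.

(** The [2n+1] values, shifted by [n], encode the integers from [-n] to [n]. Since [t] ranges over a
    finite type, only finitely many sequences arise. *)
Definition prefix_fun (n m : nat) (t : {ffun 'I_m -> 'I_(n.*2.+1)}) : ZN :=
  fun i => if insub i is Some j then (t j)%:Z - n%:Z else 0.

Lemma prefix_fun_in_group n m (t : {ffun 'I_m -> 'I_(n.*2.+1)}) :
  prefix_fun t \in matrix_group.
Proof.
apply/asboolP; split.
  exists n => i; rewrite /prefix_fun.
  by case: insubP => [j _ _|_]; [have := ltn_ord (t j); lia | rewrite normr0].
(* [c i] exceeds the column coded by [i], so the maximum of [c] lies beyond the support of every row
   [p] at once. *)
pose c (i : 'I_m) :=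
  if (unpickle i : option (nat * nat)) is Some (_, k) then k.+1 else 0%N.
move=> p; exists (\max_i c i)%N => k; rewrite /prefix_fun.
case: insubP => // j _ jE; have := leq_bigmax (F := c) j.
by rewrite {1}/c jE pickleK => /leq_trans le /le; rewrite ltnn.
Qed.

Definition bool_matrix (b : nat -> nat -> bool) : ZN :=
  fun i =>
  if (unpickle i : option (nat * nat)) is Some (n, k) then (b n k)%:Z else 0.

Lemma bool_matrixE b n k : (bool_matrix b (pickle (n, k)) : int) = (b n k)%:Z.
Proof. by rewrite /bool_matrix pickleK. Qed.

Lemma bool_matrix_in_group (b : nat -> nat -> bool) (m : nat -> nat) :
  (forall n k, b n k -> (k <= m n)%N) -> bool_matrix b \in matrix_group.
Proof.
move=> bm; apply/asboolP; split.
  exists 1%N => i; rewrite /bool_matrix.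
  by case: unpickle => [[n k]|] //; case: (b n k).
(* The successor is needed because column [m n] may still hold a 1. *)
move=> n; exists (m n).+1 => k mk; rewrite bool_matrixE.
by case: (boolP (b n k)) => // /bm; rewrite leqNgt mk.
Qed.

Definition matrix_elt (f : ZN) (fG : f \in matrix_group) : subgroup matrix_group :=
  exist (fun f => is_true (f \in matrix_group)) f fG.

Lemma matrix_group_Hurewicz_bounded : Hurewicz_bounded (subgroup matrix_group).
Proof.
move=> U U0; have /choice[m mU] := fun n => nbhs_subgroup_prefix (U0 n).
pose h n t := matrix_elt (@prefix_fun_in_group n (m n) t).
exists (fun n => range (h n)); split=> [n|g].
  by apply: finite_image; exact: finite_finset.
have /asboolP[[B gB] _] := valP g.
(* Stage [n] uses the truncations bounded by [n], so an element bounded by [B] is caught from stage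
   [B] on. *)
exists B => // n /= Bn.
(* As [B <= n], the shifted entry lies between 0 and [2n]: neither the absolute value nor [inord]
   alters it. *)
pose t := [ffun i : 'I_(m n) =>
  inord `|((val g i : int) + n%:Z)%R|%N : 'I_(n.*2.+1)].
exists (h n t); first by exists t.
exists (g - h n t); last by rewrite addrC subrK.
apply: mU => i im.
have -> : (val (g - h n t) i : int) = (val g i : int) - (prefix_fun t i : int) by [].
have := gB i; move: Bn; set z : int := val g i => Bn zB.
rewrite /prefix_fun insubT ffunE /= -/z.
by rewrite inordK; lia.
Qed.

Lemma matrix_group_not_Rothberger_bounded : ~ Rothberger_bounded (subgroup matrix_group).
Proof.
pose U (n : nat) :=
  [set g : subgroup matrix_group | (val g (pickle (n, 0%N)) : int) = 0].
move=> /(_ U)[n|a aU].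
  by apply: open_nbhs_nbhs; split=> //; exact: open_subgroup_coord0.
(* Entry [(n, 0)] is 1 if that of [a n] vanishes and 0 otherwise, whereas members of the translate
   of [U n] by [a n] share this entry with [a n]. *)
pose b (n k : nat) := (k == 0%N) && ((val (a n) (pickle (n, 0%N)) : int) == 0).
have bG : bool_matrix b \in matrix_group.
  by apply: (@bool_matrix_in_group _ (fun=> 0%N)) => n k /andP[/eqP->].
have : [set: subgroup matrix_group] (matrix_elt bG) by [].
rewrite -aU => -[n _ [_ -> [u un0 /(congr1 val) /(congr1 (@^~ (pickle (n, 0%N))))]]].
have -> : (val (a n + u) (pickle (n, 0%N)) : int) =
  (val (a n) (pickle (n, 0%N)) : int) + (val u (pickle (n, 0%N)) : int) by [].
move=> /= E; have := bool_matrixE b n 0; rewrite -E un0 addr0 /b eqxx /=.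
by case: eqP => [->|].
Qed.

Lemma matrix_group_not_Menger : ~ Menger_property (subgroup matrix_group).
Proof.
pose Z (n k : nat) :=
  [set g : subgroup matrix_group | (val g (pickle (n, k)) : int) = 0].
move=> /(_ (fun n => range (Z n)))[n|F [finF FT]].
  split=> [_ [k _ <-]|]; first exact: open_subgroup_coord0.
  rewrite -subTset => g _; have /asboolP[_ /(_ n)[K gK]] := valP g.
  by exists (Z n K); [exists K | exact: gK].
(* [F n] is a finite family of sets, not of indices: choose an index for each member (0 for sets
   outside [F n]) and bound the finitely many chosen ones. *)
have /choice[m mF] n : exists m, forall A, F n A ->
    exists2 k, (k <= m)%N & A = Z n k.
  have [finFn FZ] := finF n.
  have /choice[k kF] (A : set (subgroup matrix_group)) :
      exists k, F n A -> A = Z n k.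
    have [/FZ[k _ <-]|nA] := pselect (F n A); first by exists k.
    by exists 0%N => /nA.
  have /finite_seqP[s sE] := finite_image k finFn.
  exists (\max_(i <- s) i) => A FA; exists (k A); last exact: kF.
  have : [set` s] (k A) by rewrite -sE; exists A.
  by move=> /= ks; apply: leq_bigmax_seq.
pose b n k := (k <= m n)%N.
have bG : bool_matrix b \in matrix_group by exact: (@bool_matrix_in_group _ m).
have : [set: subgroup matrix_group] (matrix_elt bG) by [].
rewrite -FT => -[n _ [A /mF[k km ->]]].
by rewrite /Z /= bool_matrixE /b km.
Qed.

Theorem theorem9p6 :
  exists G : zmodClosed ZN,
    (Hurewicz_bounded (subgroup G) /\ Menger_bounded (subgroup G)) /\
    ~ Rothberger_bounded (subgroup G) /\
    ~ Hurewicz_property (subgroup G) /\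
    ~ Menger_property (subgroup G) /\
    ~ Rothberger_property (subgroup G).
Proof.
exists matrix_group; split; last split; last split; last split.
- split; first exact: matrix_group_Hurewicz_bounded.
  exact/Hurewicz_bounded_Menger/matrix_group_Hurewicz_bounded.
- exact: matrix_group_not_Rothberger_bounded.
- by move=> /Hurewicz_Menger /matrix_group_not_Menger.
- exact: matrix_group_not_Menger.
- by move=> /Rothberger_Menger /matrix_group_not_Menger.
Qed.
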